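(* Let $s\leq t$ be positive integers and let $k>2$ be an integer. If $D$ is a $k$-partite tournament with $\delta^+(D)\geq t+\max\{2s(s+1)^2,\ 2ks(s+1)\}$, then $D$ has a bipartition $(A,B)$ of $V(D)$ with $\delta^+(D[A])\geq s$ and $\delta^+(D[B])\geq t$.
   Context: All digraphs are finite and simple (no loops, no multiple arcs). A $k$-partite tournament is an orientation of a complete $k$-partite graph. For a digraph $D$, $\delta^+(D)$ is the minimum out-degree of $D$, and $D[A]$ is the subdigraph of $D$ induced by the vertex set $A$. A bipartition $(A,B)$ of $V(D)$ is a partition of $V(D)$ into two disjoint nonempty sets $A$ and $B$ (it need not be related to the $k$ classes of the underlying complete $k$-partite graph). *)

(* Defs.v *)
From mathcomp Require Import all_boot.

Set Implicit Arguments.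
Unset Strict Implicit.
Unset Printing Implicit Defensive.

(* A boolean relation excludes multiple arcs but allows a pair of opposite
   arcs u -> v, v -> u, as is usual for simple digraphs. *)
Record digraph (V : finType) := Digraph {
  arc :> rel V;
  arc_irr : irreflexive arc
}.

Definition outdeg (V : finType) (D : digraph V) (v : V) : nat :=
  #|[set u | D v u]|.

(* The default value #|V| is harmless: there are no loops, so every
   out-degree is at most #|V|; only for empty V is it used, giving 0. *)
Definition min_outdeg (V : finType) (D : digraph V) : nat :=
  \big[minn/#|V|]_(v : V) outdeg D v.

Definition induced (V : finType) (D : digraph V) (A : {set V}) :
    digraph {v : V | v \in A} :=
  @Digraph {v : V | v \in A} (fun u v => D (val u) (val v))
    (fun v => arc_irr D (val v)).

(* The classes are the fibres of c; surjectivity makes all k of them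
   nonempty. *)
Definition complete_multipartite (k : nat) (V : finType) (g : rel V) : Prop :=
  exists c : V -> 'I_k,
    (forall i : 'I_k, exists v : V, c v = i) /\
    (forall u v : V, g u v = (c u != c v)).

Definition orientation (V : finType) (D : digraph V) (g : rel V) : Prop :=
  (forall u v : V, g u v = D u v || D v u) /\
  (forall u v : V, ~~ (D u v && D v u)).

Definition multipartite_tournament (k : nat) (V : finType) (D : digraph V) :
    Prop :=
  exists g : rel V, complete_multipartite k g /\ orientation D g.

Definition bipartition (V : finType) (A B : {set V}) : Prop :=
  [/\ A != set0, B != set0, [disjoint A & B] & A :|: B = [set: V]].

(* Main.v *)
(* Let A be a smallest nonempty vertex set with δ⁺(D[A]) ≥ s; it suffices that
   |A| ≤ max{2s(s+1)², 2ks(s+1)}, since then B := V \ A works.  By minimality every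
   vertex of A is dominated by a vertex of out-degree exactly s in D[A], so if
   |A| > 2ks(s+1) some class C contains a set X of 2s such vertices.  Few vertices
   outside C (fewer than 2s, forming a set T) have less than s out-neighbours
   in X, by counting the 2s² arcs leaving X.  Picking s out-neighbours P(v) in A
   for each v, the set X ∪ P(X) ∪ P(T) ∪ P(P(T) ∩ C) again has minimum out-degree
   at least s, and it has at most 2s(s+1)² elements. *)
Require Import Defs.
From mathcomp Require Import all_boot zify.

Set Implicit Arguments.
Unset Strict Implicit.
Unset Printing Implicit Defensive.

Lemma min_outdeg_le (V : finType) (D : digraph V) (v : V) :
  min_outdeg D <= outdeg D v.
Proof.
rewrite /min_outdeg; have: v \in index_enum V by rewrite mem_index_enum.
elim: (index_enum V) => // u r IHr; rewrite inE big_cons geq_min.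
by case/predU1P=> [->|/IHr->]; rewrite ?leqnn ?orbT.
Qed.

(** The vertex [v0] bounds [n] by [#|V|], the default value of the minimum. *)
Lemma leq_min_outdeg (V : finType) (D : digraph V) (n : nat) (v0 : V) :
  (forall v, n <= outdeg D v) -> n <= min_outdeg D.
Proof.
move=> Dn; rewrite /min_outdeg; apply: (big_ind (leq n)) => [|x y nx ny|v _].
- exact: leq_trans (Dn v0) (max_card _).
- by rewrite leq_min nx.
- exact: Dn.
Qed.

Lemma exists_subset_card (T : finType) (A : {set T}) (n : nat) :
  n <= #|A| -> exists2 B : {set T}, B \subset A & #|B| = n.
Proof.
move=> nA; exists [set x in take n (enum A)].
  by apply/subsetP=> x; rewrite inE => /mem_take; rewrite mem_enum.
rewrite cardsE (card_uniqP _) ?take_uniq ?enum_uniq //.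
by rewrite size_take_min -cardE; apply/minn_idPl.
Qed.

Lemma card_bigcup_leq (I T : finType) (F : I -> {set T}) (A : {set I}) (n : nat) :
  (forall i, i \in A -> #|F i| <= n) -> #|\bigcup_(i in A) F i| <= #|A| * n.
Proof.
move=> Fn; rewrite -sum_nat_const.
apply: leq_trans (leq_sum _ Fn).
elim/big_rec2: _ => [|i m B _ IH]; first by rewrite cards0.
by apply: leq_trans (leq_card_setU _ _) _; rewrite leq_add2l.
Qed.

Section Core.
Variables (V : finType) (D : digraph V).

Definition outnbr (A : {set V}) (v : V) : {set V} := [set u in A | D v u].

(** Expresses δ⁺(D[A]) ≥ s for nonempty [A] inside [V] itself, so that such sets can be compared and
    modified without subtypes. *)
Definition core (s : nat) (A : {set V}) : bool :=
  (A != set0) && [forall v in A, s <= #|outnbr A v|].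

Lemma coreP s A :
  reflect (A != set0 /\ forall v, v \in A -> s <= #|outnbr A v|) (core s A).
Proof. by apply: (iffP andP) => -[A0 /forall_inP]. Qed.

Lemma outnbrS (A B : {set V}) v : A \subset B -> outnbr A v \subset outnbr B v.
Proof.
by move=> sAB; apply/subsetP=> u; rewrite !inE => /andP[/(subsetP sAB)-> ->].
Qed.

Lemma core_min_outdeg s A : core s A -> s <= min_outdeg (induced D A).
Proof.
case/coreP=> /set0Pn[v0 Av0] sA; apply: (leq_min_outdeg (exist _ v0 Av0)).
case=> v Av; apply: leq_trans (sA v Av) _.
rewrite /outdeg -(card_imset _ val_inj); apply/subset_leq_card/subsetP=> u.
rewrite inE => /andP[Au Dvu]; apply/imsetP.
by exists (exist _ u Au); rewrite ?inE.
Qed.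

(** Deleting [v] must destroy the core. What remains is nonempty, because [v] has an out-neighbour
    in [A] and no loop; so some [u] drops below [s], hence had exactly [s] out-neighbours in [A],
    one of them [v]. *)
Lemma min_core_dominated s A v :
    0 < s -> core s A -> (forall B, core s B -> #|A| <= #|B|) -> v \in A ->
  exists2 u, u \in A & (#|outnbr A u| == s) && D u v.
Proof.
move=> s0 coreA minA Av; have [A0 sA] := coreP _ _ coreA.
have: ~~ core s (A :\ v).
  by apply: contraTN isT => /minA; rewrite (cardsD1 v) Av ltnn.
rewrite negb_and negbK => /orP[/eqP Av0|/forall_inPn[u]].
  have := sA v Av; rewrite leqNgt => /negP[]; apply: leq_trans s0.
  rewrite ltnS leqn0 cards_eq0 -subset0 -Av0; apply/subsetP=> u.
  by rewrite !inE => /andP[-> Dvu]; case: eqP Dvu => // ->; rewrite arc_irr.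
rewrite in_setD1 -ltnNge => /andP[_ Au]; have sAu := sA u Au.
have ->: outnbr (A :\ v) u = outnbr A u :\ v.
  by apply/setP=> w; rewrite !inE andbA.
have := cardsD1 v (outnbr A u); rewrite {2}/outnbr inE Av /= => eqA ltA.
exists u => //; case: (D u v) eqA; lia.
Qed.

(** Adding chosen out-neighbours stops early: those of class [i] vertices lie outside the class, and
    a vertex of [A] outside both class [i] and [T] already has [s] out-neighbours in [X]. *)
Lemma small_core_of_class (s k : nat) (c : V -> 'I_k) (i : 'I_k)
    (A X : {set V}) :
    (forall u v, (D u v || D v u) = (c u != c v)) ->
    0 < s -> core s A -> X \subset A -> #|X| = 2 * s ->
    (forall x, x \in X -> c x = i /\ #|outnbr A x| = s) ->
  exists2 W, core s W & #|W| <= 2 * s * (s + 1) ^ 2.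
Proof.
move=> cD s0 /coreP[_ sA] sXA cardX Xi.
have arc_class u v : D u v -> c u != c v by move=> Duv; rewrite -cD Duv.
have /fin_all_exists[P Pdef] (v : V) :
    exists B : {set V}, v \in A -> B \subset outnbr A v /\ #|B| = s.
  have [/sA/exists_subset_card[B ? ?]|_] := boolP (v \in A); last by exists set0.
  by exists B.
pose PU (U : {set V}) := \bigcup_(v in U) P v.
have PUA (U : {set V}) : U \subset A -> PU U \subset A.
  move=> /subsetP sUA; apply/bigcupsP=> v /sUA/Pdef[/subset_trans-> //].
  by apply/subsetP=> u; rewrite inE => /andP[].
have cardPU (U : {set V}) : U \subset A -> #|PU U| <= #|U| * s.
  by move=> /subsetP sUA; apply: card_bigcup_leq => v /sUA/Pdef[_ ->].
pose T := [set u in A | (c u != i) && (#|outnbr X u| < s)].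
have sTA : T \subset A by apply/subsetP=> u; rewrite inE => /andP[].
(* [u] is adjacent to all 2s vertices of [X], which lie in another class, and dominates fewer than
   [s] of them; the others dominate [u]. *)
have Tin u : u \in T -> s < #|[set x in X | D x u]|.
  rewrite inE => /and3P[_ cui ltu].
  have: X \subset outnbr X u :|: [set x in X | D x u].
    apply/subsetP=> x Xx; rewrite !inE Xx /= cD.
    by have [-> _] := Xi x Xx.
  move/subset_leq_card; rewrite cardX => h.
  have := leq_trans h (leq_card_setU _ _); lia.
have cardT : #|T| <= 2 * s.
  (* Double counting of the arcs from [X] to [T]: at least s + 1 enter each vertex of [T], at most
     [s] leave each vertex of [X]. *)
  have: #|T| * s.+1 <= #|X| * s.
    rewrite -!sum_nat_const.
    have count (B : {set V}) (p : pred V) :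
        \sum_(x in B) p x = #|[set x in B | p x]|.
      rewrite -sum1dep_card big_mkcondr.
      by apply: eq_bigr => x _; case: (p x).
    apply: (@leq_trans (\sum_(u in T) \sum_(x in X) D x u)).
      by apply: leq_sum => u /Tin; rewrite (count X (D^~ u)).
    rewrite exchange_big; apply: leq_sum => x /Xi[_ <-].
    rewrite (count T (D x)); apply/subset_leq_card/subsetP=> u.
    by rewrite !inE => /andP[/andP[-> _] ->].
  rewrite cardX; nia.
have sPTA := PUA T sTA.
pose Z := [set z in PU T | c z == i].
have sZPT : Z \subset PU T by apply/subsetP=> z; rewrite inE => /andP[].
have sZA := subset_trans sZPT sPTA.
pose W := X :|: PU X :|: PU T :|: PU Z.
have sWA : W \subset A by rewrite !subUset sXA !PUA.
have Wdeg v : v \in A -> P v \subset W -> s <= #|outnbr W v|.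
  move=> Av sPW; have [sPA <-] := Pdef v Av.
  apply/subset_leq_card/subsetP=> u Pu; have := subsetP sPA u Pu.
  rewrite [u \in outnbr A v]inE => /andP[_ Dvu].
  by rewrite inE Dvu (subsetP sPW u Pu).
have PUsub (U : {set V}) v : v \in U -> P v \subset PU U by exact: bigcup_sup.
exists W; last first.
  have cPX : #|PU X| <= 2 * s * s by rewrite -cardX cardPU.
  have cPT : #|PU T| <= 2 * s * s.
    by apply: leq_trans (cardPU T sTA) _; rewrite leq_mul2r cardT orbT.
  have cPZ : #|PU Z| <= 2 * s * s * s.
    apply: leq_trans (cardPU Z sZA) _; rewrite leq_mul2r.
    by rewrite (leq_trans (subset_leq_card sZPT) cPT) orbT.
  (* The summands bound [X], [PU X], [PU T] and [PU Z], in this order. *)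
  have -> : 2 * s * (s + 1) ^ 2 =
      2 * s + 2 * s * s + 2 * s * s + 2 * s * s * s by nia.
  do 3![apply: leq_trans (leq_card_setU _ _) _; apply: leq_add => //].
  by rewrite cardX.
have sXW : X \subset W by rewrite /W -!setUA subsetUl.
apply/coreP; split.
  by rewrite -card_gt0 (leq_trans _ (subset_leq_card sXW)) // cardX muln_gt0.
have PUclass (U : {set V}) v :
    U \subset A -> (forall u, u \in U -> c u = i) -> v \in PU U -> c v != i.
  move=> sUA Ui /bigcupP[u Uu Pv]; have [sPA _] := Pdef u (subsetP sUA u Uu).
  have := subsetP sPA v Pv; rewrite inE => /andP[_ /arc_class].
  by rewrite (Ui u Uu) eq_sym.
have outside v : v \in A -> c v != i -> s <= #|outnbr W v|.
  move=> Av cvi; have [Tv|] := boolP (v \in T).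
    apply: Wdeg => //; apply: subset_trans (PUsub _ _ Tv) _.
    by rewrite /W -setUA setUCA subsetUl.
  rewrite inE Av cvi /= -leqNgt => /leq_trans-> //.
  exact/subset_leq_card/outnbrS.
move=> v Wv; have Av := subsetP sWA v Wv.
have [cvi|] := eqVneq (c v) i; last exact: outside.
(* [PU X] and [PU Z] avoid class [i], so [v] lies in [X] or in [Z], and [P v] was put into [W]. *)
apply: Wdeg => //; move: Wv; rewrite /W !inE -!orbA => /or4P[Xv|Pv|Pv|Pv].
- by apply: subset_trans (PUsub _ _ Xv) _; rewrite -!setUA setUCA subsetUl.
- by case/eqP: (PUclass X v sXA (fun x Xx => (Xi x Xx).1) Pv).
- have Zv : v \in Z by rewrite inE Pv cvi eqxx.
  by apply: subset_trans (PUsub _ _ Zv) _; rewrite subsetUr.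
have Zi z : z \in Z -> c z = i by rewrite inE => /andP[_ /eqP].
by case/eqP: (PUclass Z v sZA Zi Pv).
Qed.

Lemma small_core (s k : nat) (c : V -> 'I_k) :
    (forall u v, (D u v || D v u) = (c u != c v)) ->
    0 < s -> (exists A, core s A) ->
  exists2 A, core s A &
    #|A| <= maxn (2 * s * (s + 1) ^ 2) (2 * k * s * (s + 1)).
Proof.
move=> cD s0 [A0 coreA0].
case: (arg_minnP (fun A : {set V} => #|A|) coreA0) => A coreA minA.
exists A => //; rewrite leqNgt; apply/negP; rewrite gtn_max => /andP[ltA ltAk].
pose S := [set u in A | #|outnbr A u| == s].
have cardA : #|A| <= #|S| * s.
  have: #|\bigcup_(u in S) outnbr A u| <= #|S| * s.
    by apply: card_bigcup_leq => u; rewrite inE => /andP[_ /eqP->].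
  apply: leq_trans; apply/subset_leq_card/subsetP=> v Av.
  have [u Au /andP[du Duv]] := min_core_dominated s0 coreA minA Av.
  by apply/bigcupP; exists u; rewrite !inE ?Au ?Av.
(* Pigeonhole over the [k] classes: otherwise |S| ≤ 2ks, and [cardA] gives |A| ≤ 2ks², against
   [ltAk]. *)
have [i leSi] : exists i, 2 * s <= #|[set u in S | c u == i]|.
  apply/existsP; apply: contraLR ltAk => /existsPn ltS; rewrite -leqNgt.
  have: #|S| <= k * (2 * s).
    rewrite -sum1_card (partition_big c xpredT) //= -[k in k * _]card_ord.
    rewrite -sum_nat_const; apply: leq_sum => i _.
    by rewrite sum1dep_card ltnW // ltnNge ltS.
  nia.
have [X sXS cardX] := exists_subset_card leSi.
have Xin x : x \in X -> [/\ x \in A, #|outnbr A x| = s & c x = i].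
  by move/(subsetP sXS); rewrite !inE => /andP[/andP[-> /eqP->] /eqP->].
have [| |W coreW] := small_core_of_class cD s0 coreA (X := X) _ cardX (i := i).
- by apply/subsetP=> x /Xin[].
- by move=> x /Xin[].
(* By [ltA], [W] would be a core smaller than the minimum one. *)
by move/(leq_trans (minA W coreW)); rewrite leqNgt ltA.
Qed.

End Core.

Theorem corollary2 (s t k : nat) (hs : 0 < s) (hst : s <= t) (hk : 2 < k)
    (V : finType) (D : digraph V) (hD : multipartite_tournament k D)
    (hdeg : t + maxn (2 * s * (s + 1) ^ 2) (2 * k * s * (s + 1))
            <= min_outdeg D) :
  exists A B : {set V},
    [/\ bipartition A B,
        s <= min_outdeg (induced D A) &
        t <= min_outdeg (induced D B)].
Proof.
have [g [[c [c_surj gc]] [gD _]]] := hD.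
have cD u v : (D u v || D v u) = (c u != c v) by rewrite -gD gc.
set M := maxn _ _ in hdeg.
have sM : s <= M by rewrite /M leq_max; apply/orP; left; nia.
have [v0 _] := c_surj (Ordinal (ltnW (ltnW hk))).
have degD v : t + M <= outdeg D v := leq_trans hdeg (min_outdeg_le D v).
have [|A coreA leA] := small_core cD hs.
  (* The whole vertex set is a core, as every out-degree is at least M ≥ s. *)
  exists setT; apply/coreP; split=> [|v _]; first by apply/set0Pn; exists v0.
  have -> : outnbr D setT v = [set u | D v u] by apply/setP=> u; rewrite !inE.
  exact: leq_trans (leq_trans sM (leq_addl t M)) (degD v).
(* Of the at least t + M out-neighbours of [v], at most |A| ≤ M lie in [A]. This holds for every
   [v], so it also shows that the complement is nonempty. *)
have tB v : t <= #|outnbr D (~: A) v|.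
  have sub : [set u | D v u] \subset A :|: outnbr D (~: A) v.
    by apply/subsetP=> u; rewrite !inE => ->; rewrite andbT orbN.
  rewrite -(leq_add2r M); apply: leq_trans (degD v) _.
  apply: leq_trans (subset_leq_card sub) _; rewrite addnC.
  by apply: leq_trans (leq_card_setU _ _) _; rewrite leq_add2r.
have B0 : ~: A != set0.
  have: 0 < #|outnbr D (~: A) v0| := leq_trans (leq_trans hs hst) (tB v0).
  rewrite card_gt0 => /set0Pn[u]; rewrite inE => /andP[Bu _].
  by apply/set0Pn; exists u.
exists A, (~: A); split.
- by case/coreP: coreA => A0 _; split; rewrite ?setUCr // -setI_eq0 setICr.
- exact: core_min_outdeg.
- by apply/core_min_outdeg/coreP.
Qed.
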